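(* Let $n\ge 1$ and $\pi\in S_n$. Any algorithm which, starting from $\pi$, at each step places either the smallest or the largest number that is not currently at home (until the identity is reached) terminates in at most $n-1$ steps.
   Context: A permutation $\pi\in S_n$ is written as the sequence $\pi(1),\dots,\pi(n)$, where $\pi(i)$ is the number in the $i$th position and $\pi^{-1}(i)$ is the position of the number $i$. A number $i$ is at home if $\pi(i)=i$. If $i$ is not at home, it may be placed: $i$ is removed from its current position $\pi^{-1}(i)$ and reinserted at position $i$, the numbers in the intervening positions each shifting by one position toward the vacated position, and all other numbers staying where they are. Each placement is one step. At each step the available numbers are those not at home; the choice between smallest and largest may be made arbitrarily at each step. *)

(* Defs.v *)
From mathcomp Require Import all_boot all_fingroup.
From mathcomp Require Import zify.

Set Implicit Arguments.
Unset Strict Implicit.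
Unset Printing Implicit Defensive.

(* A permutation s : 'S_n is read as the arrangement s 0, ..., s (n - 1): s j   *)
(* is the number in position j. Numbers and positions start at 0, not at 1.     *)

(* When the number in position p is removed and reinserted in position i, the   *)
(* number that ends up in position j is the one that was in position            *)
(* move_src p i j. ordS and ord_pred are only used where they do not wrap       *)
(* around, so they are j + 1 and j - 1.                                         *)
Definition move_src (n : nat) (p i j : 'I_n) : 'I_n :=
  if j == i then p
  else if p <= j < i then ordS j
  else if i < j <= p then ord_pred j
  else j.

Lemma move_src_inj (n : nat) (p i : 'I_n) : injective (move_src p i).
Proof.
have valS (j k : 'I_n) : j < k -> ordS j = j.+1 :> nat.
  by move=> jk; rewrite /= modn_small // (leq_ltn_trans jk).
have valP (j k : 'I_n) : k < j -> ord_pred j = j.-1 :> nat.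
  move=> kj; have j_gt0 : 0 < j := leq_ltn_trans (leq0n k) kj.
  rewrite /= -subn1 -addnBAC // modnDr subn1 modn_small //.
  by rewrite (leq_ltn_trans (leq_pred j)).
have srcE j : move_src p i j = (if j == i :> nat then p : nat
    else if p <= j < i then j.+1 else if i < j <= p then j.-1 else j) :> nat.
  rewrite /move_src -val_eqE /=; case: ifP => // _.
  case: ifP => [/andP[_ /valS] //|_].
  by case: ifP => [/andP[/valP] //|_].
move=> j k /(congr1 val) /=; rewrite !srcE => e; apply: val_inj => /=.
by move: e; do !case: ifP; lia.
Qed.

Definition place (n : nat) (s : 'S_n) (i : 'I_n) : 'S_n :=
  (perm (@move_src_inj n ((s^-1)%g i) i) * s)%g.

Definition at_home (n : nat) (s : 'S_n) (i : 'I_n) : bool := s i == i.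

Definition smallest_away (n : nat) (s : 'S_n) (i : 'I_n) : bool :=
  ~~ at_home s i && [forall j, ~~ at_home s j ==> (i <= j)].

Definition largest_away (n : nat) (s : 'S_n) (i : 'I_n) : bool :=
  ~~ at_home s i && [forall j, ~~ at_home s j ==> (j <= i)].

(* Nondeterministic in the choice between smallest and largest, so that a path  *)
(* of this relation is a run of an arbitrary algorithm.                         *)
Definition extremal_step (n : nat) : rel 'S_n := fun s t =>
  [exists i, (smallest_away s i || largest_away s i) && (t == place s i)].

(* Main.v *)
Require Import Defs.
From mathcomp Require Import all_boot all_fingroup.
From mathcomp Require Import zify.

(** The numbers that are away from home lie in an interval [lo, hi), and so do
    their positions, since position [i] is occupied by a foreign number exactly
    when the number [i] is away. Placing a number only disturbs the positions
    between its old and its new one, hence nothing outside the interval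
    ([place_outside], [away_within_place]). If the placed number is an extreme
    of the away numbers, its home is at an end of the interval that they span,
    so it can be cut off once at home: each step shortens the interval by at
    least 1. A number cannot be the only one away: the number that occupies its
    home is away too ([away_perm]). Hence a step is possible only while the
    interval has length at least 2, and starting from length [n] there is room
    for at most [n - 1] steps ([size_run_le]). A run can stop only at the
    identity because a nonempty finite set of away numbers has a smallest
    element. *)

Section Placement.

Variable n : nat.
Implicit Types (s t : 'S_n) (i j : 'I_n).

Lemma away_perm s i : ~~ at_home s i -> ~~ at_home s (s i).
Proof. by rewrite /at_home (inj_eq perm_inj). Qed.

Lemma away_permV s i : ~~ at_home s i -> ~~ at_home s (s^-1 i)%g.
Proof.
by apply: contraNN; rewrite /at_home permKV => /eqP {1}->; rewrite permKV.
Qed.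

Lemma at_home_place s i : at_home (place s i) i.
Proof. by rewrite /at_home permM permE /move_src eqxx permKV. Qed.

Lemma place_outside s i j :
  (j < minn i (s^-1 i)%g) || (maxn i (s^-1 i)%g < j) -> place s i j = s j.
Proof.
move=> out; rewrite permM permE /move_src -val_eqE /=.
by do !case: ifP => //; move: out; lia.
Qed.

Definition away_within s (lo hi : nat) : Prop :=
  forall i, ~~ at_home s i -> lo <= i < hi.

(** Of [i] and its position only a common interval is known, which is enough:
    positions outside it keep their occupants, so if such a position holds a
    foreign number afterwards, it already did before. *)
Lemma away_within_place s lo hi i j : away_within s lo hi -> ~~ at_home s i ->
  ~~ at_home (place s i) j -> (lo <= j < hi) && (j != i :> nat).
Proof.
move=> s_in i_away j_away; apply/andP; split; last first.
  by apply: contraNneq j_away => /val_inj ->; apply: at_home_place.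
apply: contraT => j_out.
have := s_in _ i_away; have := s_in _ (away_permV _ _ i_away) => p_in i_in.
case/negP: (j_out); apply: s_in; move: j_away.
by rewrite /at_home place_outside //; move: j_out p_in i_in; lia.
Qed.

(** As [i] is smallest, [lo] may be raised to [i] before the placement and, [i]
    then being at home, to [i.+1] after it. *)
Lemma away_within_place_smallest s lo hi i : away_within s lo hi ->
  smallest_away s i -> away_within (place s i) i.+1 hi.
Proof.
move=> s_in /andP[i_away /forallP i_min] j j_away.
have s_in' : away_within s i hi.
  by move=> k k_away; move: (i_min k) (s_in k k_away); rewrite k_away /=; lia.
by have := away_within_place _ _ _ _ _ s_in' i_away j_away; lia.
Qed.

Lemma away_within_place_largest s lo hi i : away_within s lo hi ->
  largest_away s i -> away_within (place s i) lo i.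
Proof.
move=> s_in /andP[i_away /forallP i_max] j j_away.
have s_in' : away_within s lo i.+1.
  by move=> k k_away; move: (i_max k) (s_in k k_away); rewrite k_away /=; lia.
by have := away_within_place _ _ _ _ _ s_in' i_away j_away; lia.
Qed.

(** The bounds are arbitrary rather than the extremes of the away numbers, so
    that the induction needs no tight interval: the truncated predecessor also
    covers the identity, for which every interval is admissible. *)
Lemma size_run_le r s lo hi : away_within s lo hi ->
  path (@extremal_step n) s r -> size r <= (hi - lo).-1.
Proof.
elim: r s lo hi => [|t r IHr] s lo hi s_in //= /andP[].
case/existsP=> i /andP[i_ext /eqP ->] r_run.
have i_away : ~~ at_home s i by case/orP: i_ext => /andP[].
(* A second away number, so that the interval has length at least 2. *)
have si_away := away_perm _ _ i_away.
have si_neq : s i != i :> nat by [].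
have i_in := s_in _ i_away; have si_in := s_in _ si_away.
case/orP: i_ext => i_ext.
- have := IHr _ _ _ (away_within_place_smallest _ _ _ _ s_in i_ext) r_run.
  case/andP: i_ext => _ /forallP/(_ (s i)); rewrite si_away /=.
  by move: i_in si_in si_neq; lia.
- have := IHr _ _ _ (away_within_place_largest _ _ _ _ s_in i_ext) r_run.
  case/andP: i_ext => _ /forallP/(_ (s i)); rewrite si_away /=.
  by move: i_in si_in si_neq; lia.
Qed.

Lemma extremal_step_exists s :
  (exists t, extremal_step s t) <-> s <> 1%g.
Proof.
split=> [[t /existsP[i /andP[i_ext _]]] s1|s_neq1].
  have : ~~ at_home s i by case/orP: i_ext => /andP[].
  by rewrite /at_home s1 perm1 eqxx.
have [i0 i0_away] : exists i, ~~ at_home s i.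
  apply/existsP; rewrite -negb_forall; apply/negP => /forallP s_home.
  by apply: s_neq1; apply/permP => i; rewrite perm1; apply/eqP/s_home.
case: (@arg_minnP _ i0 [pred i | ~~ at_home s i] val i0_away) => i i_away i_min.
exists (place s i); apply/existsP; exists i; rewrite eqxx andbT.
apply/orP; left; apply/andP; split; first exact: i_away.
by apply/forallP => j; apply/implyP/i_min.
Qed.

End Placement.

Theorem theorem4p1 (n : nat) (n_ge1 : 1 <= n) (s : 'S_n) (r : seq 'S_n)
    (r_run : path (@extremal_step n) s r) :
  size r <= n.-1 /\
  ((exists t : 'S_n, extremal_step (last s r) t) <-> last s r <> 1%g).
Proof.
split; last exact: extremal_step_exists.
rewrite -[n in n.-1]subn0; apply: size_run_le r_run => i _.
by rewrite ltn_ord.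
Qed.
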